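(* For all $t=0,\dots,T$, all $m_t\in\mathcal{M}_t$ and all $u_t\in\mathcal{U}$, $$Q_t^{\mathrm{tm}}(m_t,u_t)=Q_t(m_t,u_t)+\max_{a_t\in[[A_t|m_t]]}a_t,\qquad V_t^{\mathrm{tm}}(m_t)=V_t(m_t)+\max_{a_t\in[[A_t|m_t]]}a_t .$$ Furthermore, the strategy $\boldsymbol{g}^*=(g_0^*,\dots,g_T^* )$ with $g_t^*(m_t)\in\arg\min_{u_t\in\mathcal{U}}Q_t(m_t,u_t)$ for all $t$ and $m_t$ is optimal, i.e. $\mathcal{J}(\boldsymbol{g}^* )=\min_{\boldsymbol{g}\in\mathcal{G}}\mathcal{J}(\boldsymbol{g})$.
   Context: **System.** Let $T\in\mathbb{N}$ and let $\mathcal{X},\mathcal{U},\mathcal{Y},\mathcal{W},\mathcal{N}$ be finite nonempty subsets of a metric space $(\mathcal{S},d)$. The data are functions $f_t:\mathcal{X}\times\mathcal{U}\times\mathcal{W}\to\mathcal{X}$ ($t=0,\dots,T-1$), $h_t:\mathcal{X}\times\mathcal{N}\to\mathcal{Y}$ and $c_t:\mathcal{X}\times\mathcal{U}\to\mathbb{R}_{\ge0}$ ($t=0,\dots,T$). The state evolves by $X_{t+1}=f_t(X_t,U_t,W_t)$ from $X_0\in\mathcal{X}$, the observation is $Y_t=h_t(X_t,N_t)$, and the memory is $M_t=(Y_{0:t},U_{0:t-1})$ (so $M_0=Y_0$). The accrued cost is $A_t=\sum_{\ell=0}^{t-1}c_\ell(X_\ell,U_\ell)$, $A_0=0$, taking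 values in a finite set $\mathcal{A}_t\subset\mathbb{R}_{\ge0}$. The uncontrolled inputs $X_0$, $W_t$ ($t\le T-1$), $N_t$ ($t\le T$) are mutually independent in the non-stochastic sense: their joint range is the full product of $\mathcal{X}$, copies of $\mathcal{W}$ and copies of $\mathcal{N}$. **Ranges.** An uncertain variable is a map on a sample space $\Omega$. For uncertain variables $\mathsf{X},\mathsf{Y}$, $[[\mathsf{X}]]=\{\mathsf{X}(\omega):\omega\in\Omega\}$ and $[[\mathsf{X}|\mathsf{y}]]=\{\mathsf{X}(\omega):\omega\in\Omega,\ \mathsf{Y}(\omega)=\mathsf{y}\}$; tuples are treated as single uncertain variables. Conditional ranges of system variables given realizations such as $m_t$ or $(m_t,u_t)$ do not depend on a strategy: they are taken on $\Omega=\mathcal{X}\times\mathcal{W}^{T}\times\mathcal{N}^{T+1}\times\mathcal{U}^{T+1}$, the set of all realizations of the uncontrolled inputs and of action sequences $u_{0:T}$. $\mathcal{M}_t=[[M_t]]$ is the set of realizable memories. **Indicator and accrued distribution.** $\mathbb{I}(\mathsf{x}|\mathsf{y})=0$ if $\mathsf{x}\in[[\mathsf{X}|\mathsf{y}]]$ and $-\infty$ otherwise. For $\mathsf{y}\in[[\mathsf{Y}]]$, $$r_t(\mathsf{x}|\mathsf{y})=\max_{a_t\in\mathcal{A}_t}\big(a_t+\mathbb{I}(\mathsf{x},a_t|\mathsf{y})\big)-\max_{a_t\in\mathcal{A}_t}\big(a_t+\mathbb{I}(a_t|\mathsf{y})\big)\in\{-\infty\}\cup(-\infty,0],$$ with a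 real number plus $-\infty$ equal to $-\infty$. **Problem.** $\mathcal{G}$ is the set of strategies $\boldsymbol{g}=(g_0,\dots,g_T)$ with $g_t:\mathcal{M}_t\to\mathcal{U}$; under $\boldsymbol{g}$ the action is $U_t=g_t(M_t)$, and $$\mathcal{J}(\boldsymbol{g})=\max_{x_0\in\mathcal{X},\,n_{0:T}\in\mathcal{N}^{T+1},\,w_{0:T-1}\in\mathcal{W}^{T}}\ \sum_{t=0}^T c_t(X_t,U_t).$$ **Terminal-cost dynamic program.** $Q_T^{\mathrm{tm}}(m_T,u_T)=\max_{(a_T,x_T)\in[[A_T,X_T|m_T,u_T]]}(c_T(x_T,u_T)+a_T)$; for $t<T$, $Q_t^{\mathrm{tm}}(m_t,u_t)=\max_{m_{t+1}\in[[M_{t+1}|m_t,u_t]]}V_{t+1}^{\mathrm{tm}}(m_{t+1})$; for all $t$, $V_t^{\mathrm{tm}}(m_t)=\min_{u_t\in\mathcal{U}}Q_t^{\mathrm{tm}}(m_t,u_t)$. **Specialized dynamic program.** $Q_T(m_T,u_T)=\max_{x_T\in\mathcal{X}}(c_T(x_T,u_T)+r_T(x_T|m_T))$; for $t<T$, $$Q_t(m_t,u_t)=\max_{x_t\in\mathcal{X},\,m_{t+1}\in\mathcal{M}_{t+1}}\big(c_t(x_t,u_t)+V_{t+1}(m_{t+1})+r_t(x_t,m_{t+1}|m_t,u_t)\big);$$ for all $t$, $V_t(m_t)=\min_{u_t\in\mathcal{U}}Q_t(m_t,u_t)$. *)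

(* Defs.v *)
From mathcomp Require Import all_boot all_order all_algebra finmap.
From mathcomp Require Import all_classical all_reals all_analysis.
Set Implicit Arguments.
Unset Strict Implicit.
Unset Printing Implicit Defensive.
Import Order.TTheory GRing.Theory Num.Theory.
Local Open Scope fset_scope.
Local Open Scope ring_scope.

(* Values that may be -oo live in \bar R.  A maximum over a finite index set
   is \big[maxe/-oo] and a minimum is \big[mine/+oo]; all the index sets are
   nonempty where the mathematics needs it, so that -oo and +oo are mere
   neutral elements. *)

Section UncertainVariables.
Context (R : realType) (Omega : finType).

Definition urange (A : choiceType) (F : Omega -> A) : {fset A} :=
  [fset F o | o : Omega].

Definition crange (A : choiceType) (B : eqType) (F : Omega -> A)
    (G : Omega -> B) (b : B) : {fset A} :=
  [fset F o | o : Omega & G o == b].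

Definition indicator (A : choiceType) (B : eqType) (F : Omega -> A)
    (G : Omega -> B) (a : A) (b : B) : \bar R :=
  (if a \in crange F G b then 0 else -oo)%E.

(* The accrued distribution r(x|y) of F given G, where Acc is the accrued cost
   and cA a finite set containing its values. *)
Definition accrued_dist (cA : {fset R}) (Acc : Omega -> R)
    (A : choiceType) (B : eqType) (F : Omega -> A) (G : Omega -> B)
    (x : A) (y : B) : \bar R :=
  (\big[maxe/-oo]_(a <- cA)
      (a%:E + indicator (fun o => (F o, Acc o)) G (x, a) y)
   - \big[maxe/-oo]_(a <- cA) (a%:E + indicator Acc G a y))%E.

End UncertainVariables.

Section System.
Context (R : realType) (T : nat) (X U Y W N : finType).

(* A memory (y_{0:t}, u_{0:t-1}). *)
Definition memory : choiceType := (seq Y * seq U)%type.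

(* Realizations (x_0, w_{0:T-1}, n_{0:T}) of the uncontrolled inputs. *)
Definition noise : finType :=
  (X * {ffun 'I_T -> W} * {ffun 'I_T.+1 -> N})%type.

(* The sample space: uncontrolled inputs and action sequences u_{0:T}. *)
Definition sample : finType := (noise * {ffun 'I_T.+1 -> U})%type.

(* The values of g_t at sequences that are not realizable memories at time t
   are irrelevant: such sequences never arise under any strategy. *)
Definition strategy : Type := 'I_T.+1 -> memory -> U.

Context (f : 'I_T -> X -> U -> W -> X) (h : 'I_T.+1 -> X -> N -> Y)
        (c : 'I_T.+1 -> X -> U -> R).

(* Times are natural numbers, read through inord : nat -> 'I_T.+1; only the
   times t <= T are meaningful. *)

Definition init_state (xi : noise) : X := xi.1.1.

Definition next_state (xi : noise) (t : nat) (x : X) (u : U) : X :=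
  if insub t is Some i then f i x u (xi.1.2 i) else x.

Definition observe (xi : noise) (t : nat) (x : X) : Y :=
  h (inord t) x (xi.2 (inord t)).

(* The pair (X_t, M_t) when the actions are U_t = g_t(M_t). *)
Fixpoint run (g : strategy) (xi : noise) (t : nat) : X * memory :=
  if t is s.+1 then
    let: (x, m) := run g xi s in
    let u := g (inord s) m in
    let x' := next_state xi s x u in
    (x', (rcons m.1 (observe xi s.+1 x'), rcons m.2 u))
  else (init_state xi, ([:: observe xi 0 (init_state xi)], [::])).

Definition run_state g xi t : X := (run g xi t).1.
Definition run_action g xi t : U := g (inord t) (run g xi t).2.

Definition total_cost (g : strategy) (xi : noise) : R :=
  \sum_(t < T.+1) c t (run_state g xi t) (run_action g xi t).

Definition J (g : strategy) : \bar R :=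
  (\big[maxe/-oo]_(xi : noise) (total_cost g xi)%:E)%E.

(* System variables on the sample space: the actions are those of the sample,
   that is, the run is the one of the open-loop strategy. *)
Definition open_loop (o : sample) : strategy := fun t _ => o.2 t.

Definition X_ (t : nat) (o : sample) : X := (run (open_loop o) o.1 t).1.
Definition M_ (t : nat) (o : sample) : memory := (run (open_loop o) o.1 t).2.
Definition U_ (t : nat) (o : sample) : U := o.2 (inord t).
Definition A_ (t : nat) (o : sample) : R :=
  \sum_(l < t) c (inord l) (X_ l o) (U_ l o).

Definition memories (t : nat) : {fset memory} := urange (M_ t).

Lemma M_0 o : M_ 0 o = ([:: observe o.1 0 (X_ 0 o)], [::]).
Proof. by []. Qed.

Lemma M_S t o : M_ t.+1 o =
  (rcons (M_ t o).1 (observe o.1 t.+1 (X_ t.+1 o)), rcons (M_ t o).2 (U_ t o)).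
Proof. by rewrite /M_ /X_ /=; case: (run _ _ _). Qed.

Lemma X_S t o : X_ t.+1 o = next_state o.1 t (X_ t o) (U_ t o).
Proof. by rewrite /X_ /=; case: (run _ _ _). Qed.

(* Backward recursion on t = T, ..., 0, where [step t] maps the value function
   at time t.+1 to the action-value function at time t. *)
Definition minval (Q : memory -> U -> \bar R) (m : memory) : \bar R :=
  (\big[mine/+oo]_(u : U) Q m u)%E.

Fixpoint backward (last : memory -> U -> \bar R)
    (step : nat -> (memory -> \bar R) -> memory -> U -> \bar R) (k : nat) :
    memory -> U -> \bar R :=
  if k is j.+1 then step (T - k)%N (minval (backward last step j)) else last.

Lemma backward_last last step : backward last step (T - T) = last.
Proof. by rewrite subnn. Qed.

Lemma backward_step last step t : (t < T)%N ->
  backward last step (T - t) = step t (minval (backward last step (T - t.+1))).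
Proof.
move=> ltT; rewrite subnS -(prednK (_ : 0 < T - t)%N) ?subn_gt0 //=.
by rewrite prednK ?subn_gt0 // subKn // ltnW.
Qed.

Definition Qtm_last (m : memory) (u : U) : \bar R :=
  (\big[maxe/-oo]_(ax <- crange (fun o => (A_ T o, X_ T o))
                               (fun o => (M_ T o, U_ T o)) (m, u))
     (c ord_max ax.2 u + ax.1)%:E)%E.

Definition Qtm_step (t : nat) (V : memory -> \bar R) (m : memory) (u : U) : \bar R :=
  (\big[maxe/-oo]_(m' <- crange (M_ t.+1)
                               (fun o => (M_ t o, U_ t o)) (m, u)) V m')%E.

Definition Qtm (t : nat) : memory -> U -> \bar R :=
  backward Qtm_last Qtm_step (T - t).
Definition Vtm (t : nat) : memory -> \bar R := minval (Qtm t).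

Lemma QtmT : Qtm T = Qtm_last.
Proof. exact: backward_last. Qed.

Lemma QtmE t : (t < T)%N -> Qtm t = Qtm_step t (Vtm t.+1).
Proof. exact: backward_step. Qed.

(* cA t is the finite set of nonnegative reals in which A_t takes values. *)
Context (cA : 'I_T.+1 -> {fset R}).

Definition Q_last (m : memory) (u : U) : \bar R :=
  (\big[maxe/-oo]_(x : X)
     ((c ord_max x u)%:E
      + accrued_dist (cA ord_max) (A_ T) (X_ T) (M_ T) x m))%E.

Definition Q_step (t : nat) (V : memory -> \bar R) (m : memory) (u : U) : \bar R :=
  (\big[maxe/-oo]_(x : X) \big[maxe/-oo]_(m' <- memories t.+1)
     ((c (inord t) x u)%:E + V m'
      + accrued_dist (cA (inord t)) (A_ t)
          (fun o => (X_ t o, M_ t.+1 o)) (fun o => (M_ t o, U_ t o))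
          (x, m') (m, u)))%E.

Definition Q (t : nat) : memory -> U -> \bar R :=
  backward Q_last Q_step (T - t).
Definition V (t : nat) : memory -> \bar R := minval (Q t).

Lemma QT : Q T = Q_last.
Proof. exact: backward_last. Qed.

Lemma QE t : (t < T)%N -> Q t = Q_step t (V t.+1).
Proof. exact: backward_step. Qed.

Definition max_accrued (t : nat) (m : memory) : \bar R :=
  (\big[maxe/-oo]_(a <- crange (A_ t) (M_ t) m) a%:E)%E.

End System.

(* Main.v *)
Require Import Defs.
From mathcomp Require Import all_boot all_order all_algebra finmap.
From mathcomp Require Import all_classical all_reals all_analysis.
Import Order.TTheory GRing.Theory Num.Theory.
Local Open Scope fset_scope.
Local Open Scope ring_scope.

(** Both dynamic programs maximize over the samples compatible with what the
agent knows, and they differ only in when the accrued cost is counted.  The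
terminal-cost program carries it along and counts it at time T; the specialized
program pays c_t at time t and keeps of the past only the distribution r_t,
which is normalized by subtracting the largest accrued cost compatible with
(m_t, u_t).

Equality of the two programs, up to max [[A_t | m_t]], is a backward induction.
The action u_t influences neither A_t nor m_t, so conditioning on (m_t, u_t)
leaves the range of (X_t, A_t) given m_t as it is ([bigmaxe_free_action]); hence
adding max [[A_t | m_t]] to Q_t(m_t, u_t) cancels the normalization of r_t.  What
remains ([Q_step_accrued]) is the maximum, over the samples o through
(m_t, u_t), of
     A_t(o) + c_t(X_t(o), u_t) + V_(t+1)(M_(t+1)(o)).
The first two terms add up to A_(t+1)(o).  Since M_(t+1) determines M_t and U_t,
the samples through (m_t, u_t) are grouped by the value m' of M_(t+1), and on
each whole group V_(t+1)(m') + max [[A_(t+1) | m']] is the terminal-cost value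
at m' by induction.

For optimality, a closed-loop run under g is the same thing as a sample whose
actions obey g ([run_follows], [follows_closed_loop]).  Let [value g t] be the
largest terminal-cost value at time t along the samples which obey g before t.
If a sample o obeys g up to time t, every sample with the same memory does too
([eq_follows]), so the maximum over m_(t+1) in the definition of Q^tm_t ranges
exactly over the continuations which obey g.  Therefore [value g t] is
nondecreasing in t, its last step leads to J(g), and it stays constant when g_t(m_t)
minimizes Q^tm_t(m_t, .) at every memory.  As [value g 0] is the same for all
strategies, it is a lower bound of J, attained by such a g.  By the first part,
Q_t and Q^tm_t have the same minimizers over u_t, because they differ by a real
number which does not depend on u_t. *)

(** * Maxima and minima of extended reals *)

Section Maxima.
Context {R : realType}.
Local Open Scope ereal_scope.

Lemma bigmaxe_leP (I : eqType) (r : seq I) (P : pred I) (F : I -> \bar R) v :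
  reflect (forall i, i \in r -> P i -> F i <= v)
          (\big[maxe/-oo]_(i <- r | P i) F i <= v).
Proof.
apply: (iffP idP) => [le_v i ri Pi|le_v].
  exact: le_trans (le_bigmax_seq _ _ _ _ ri Pi) le_v.
rewrite big_seq_cond; elim/big_ind: _ => [|x y xv yv|i /andP[]].
- exact: leNye.
- by rewrite ge_max xv.
- exact: le_v.
Qed.

Lemma bigmaxe_finP (I : finType) (P : pred I) (F : I -> \bar R) v :
  reflect (forall i, P i -> F i <= v) (\big[maxe/-oo]_(i | P i) F i <= v).
Proof.
apply: (iffP (bigmaxe_leP _ _ _ _ _)) => le_v i; last by move=> _; apply: le_v.
by apply: le_v; rewrite mem_index_enum.
Qed.

(** Suited to maxima over index sets that are not in bijection, for which upper
bounds are easier to compare than the lists of terms. *)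
Lemma eq_upper_bounds (x y : \bar R) : (forall v, x <= v <-> y <= v) -> x = y.
Proof.
by move=> xy; apply/le_anti/andP; split; [apply/xy|apply/xy]; exact: lexx.
Qed.

(** This holds even at v = +oo: since -oo absorbs +oo in a sum, every translation
fixes the neutral element -oo. *)
Lemma bigmaxeDr (I : Type) (r : seq I) (P : pred I) (F : I -> \bar R) v :
  \big[maxe/-oo]_(i <- r | P i) F i + v =
  \big[maxe/-oo]_(i <- r | P i) (F i + v).
Proof.
apply: (big_morph (fun x => x + v)) => [x y|]; last by rewrite addNye.
case: (leP x y) => [xy|/ltW yx]; apply/esym.
  by apply/max_idPr/leeD2r.
by apply/max_idPl/leeD2r.
Qed.

(** Here [v] must be finite, since v = -oo would not fix the neutral element
+oo. *)
Lemma bigmineDr (I : Type) (r : seq I) (P : pred I) (F : I -> \bar R) v :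
  v \is a fin_num ->
  \big[mine/+oo]_(i <- r | P i) F i + v =
  \big[mine/+oo]_(i <- r | P i) (F i + v).
Proof.
move=> vfin; apply: (big_morph (fun x => x + v)) => [x y|]; last first.
  by move: vfin; case: v.
case: (leP x y) => [xy|/ltW yx]; apply/esym.
  by apply/min_idPl/leeD2r.
by apply/min_idPr/leeD2r.
Qed.

(** This turns the maxima over realizations (x_t, m_(t+1)) of the specialized
program into one maximum over samples; values in [r] which are not attained
contribute empty maxima. *)
Lemma bigmaxe_fibers (I : finType) (K : eqType) (r : seq K) (P : pred I)
    (k : I -> K) (F : K -> I -> \bar R) :
  (forall i, k i \in r) ->
  \big[maxe/-oo]_(j <- r) \big[maxe/-oo]_(i | P i && (k i == j)) F j i =
  \big[maxe/-oo]_(i | P i) F (k i) i.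
Proof.
move=> kr; apply: eq_upper_bounds => v; split.
  move/bigmaxe_leP => le_v; apply/bigmaxe_finP => i Pi.
  have /bigmaxe_finP := le_v _ (kr i) isT.
  by apply; rewrite Pi eqxx.
move=> /bigmaxe_finP le_v; apply/bigmaxe_leP => j _ _; apply/bigmaxe_finP.
by move=> i /andP[Pi /eqP <-]; apply: le_v.
Qed.

Lemma bigmaxe_fin_num (I : finType) (P : pred I) (F : I -> R) i :
  P i -> \big[maxe/-oo]_(j | P j) (F j)%:E \is a fin_num.
Proof.
move=> Pi; rewrite fin_numE -ltNye -ltey; apply/andP; split.
  apply: (lt_le_trans (ltNyr (F i))).
  exact: (le_bigmax_cond _ (fun j => (F j)%:E) Pi).
by apply/bigmax_ltP; split=> [|j _]; [|exact: ltry].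
Qed.

End Maxima.

(** * Conditional ranges and accrued distributions *)

Section Ranges.
Context {R : realType} {Omega : finType}.
Local Open Scope ereal_scope.

Lemma crangeP (A : choiceType) (B : eqType) (F : Omega -> A) (G : Omega -> B)
    a b :
  reflect (exists2 o, G o = b & a = F o) (a \in crange F G b).
Proof.
apply: (iffP (imfsetP _ _ _ _)) => [[ o]|[ o Go ->]].
  by rewrite inE => /eqP; exists o.
by exists o; rewrite ?inE ?Go ?eqxx.
Qed.

Lemma bigmaxe_crange (A : choiceType) (B : eqType) (F : Omega -> A)
    (G : Omega -> B) b (phi : A -> \bar R) :
  \big[maxe/-oo]_(a <- crange F G b) phi a =
  \big[maxe/-oo]_(o | G o == b) phi (F o).
Proof.
apply: eq_upper_bounds => v; split.
  move=> /bigmaxe_leP le_v; apply/bigmaxe_finP => o /eqP Go.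
  by apply: le_v => //; apply/crangeP; exists o.
move=> /bigmaxe_finP le_v; apply/bigmaxe_leP => a /crangeP[ o Go ->] _.
by apply: le_v; rewrite Go.
Qed.

(** Adding an indicator to the objective restricts the maximum to the
realizations where it vanishes. *)
Lemma bigmaxe_indicator (cA : {fset R}) (Acc : Omega -> R) (P : pred Omega)
    (ind : R -> \bar R) :
  (forall o, Acc o \in cA) ->
  (forall a, ind a = if [exists o, P o && (Acc o == a)] then 0 else -oo) ->
  \big[maxe/-oo]_(a <- cA) (a%:E + ind a) =
  \big[maxe/-oo]_(o | P o) (Acc o)%:E.
Proof.
move=> AccA indE; apply: eq_upper_bounds => v; split.
  move=> /bigmaxe_leP le_v; apply/bigmaxe_finP => o Po.
  have := le_v _ (AccA o) isT; rewrite indE ifT ?adde0 //.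
  by apply/existsP; exists o; rewrite Po eqxx.
move=> /bigmaxe_finP le_v; apply/bigmaxe_leP => a _ _; rewrite indE.
case: existsP => [[ o /andP[Po /eqP <-]]|_]; last by rewrite addeNy leNye.
by rewrite adde0; apply: le_v.
Qed.

(** When [x] is incompatible with [y] the first maximum is empty, which gives the
value -oo of the distribution. *)
Lemma accrued_distE (cA : {fset R}) (Acc : Omega -> R) (A : choiceType)
    (B : eqType) (F : Omega -> A) (G : Omega -> B) x y :
  (forall o, Acc o \in cA) ->
  accrued_dist cA Acc F G x y =
  \big[maxe/-oo]_(o | (G o == y) && (F o == x)) (Acc o)%:E
  - \big[maxe/-oo]_(o | G o == y) (Acc o)%:E.
Proof.
move=> AccA; rewrite /accrued_dist /indicator; congr (_ - _).
  apply: bigmaxe_indicator => // a.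
  congr (if _ then _ else _); apply/crangeP/existsP => -[ o].
    by move=> Go [Fo Ao]; exists o; rewrite Go Fo Ao !eqxx.
  by case/andP=> /andP[/eqP Go /eqP <-] /eqP <-; exists o.
apply: bigmaxe_indicator => // a.
congr (if _ then _ else _); apply/crangeP/existsP => -[ o].
  by move=> Go Ao; exists o; rewrite Go Ao !eqxx.
by case/andP=> /eqP Go /eqP <-; exists o.
Qed.

End Ranges.

(** * Samples: what the memory determines, what the action does not change *)

Section System.
Context {R : realType} {T : nat} {X U Y W N : finType}.
Context (f : 'I_T -> X -> U -> W -> X) (h : 'I_T.+1 -> X -> N -> Y)
        (c : 'I_T.+1 -> X -> U -> R) (cA : 'I_T.+1 -> {fset R}).
Context (A_in : forall (t : 'I_T.+1) (o : sample T X U W N),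
  A_ f h c t o \in cA t).
Local Notation X_ := (X_ f h).
Local Notation M_ := (M_ f h).
Local Notation A_ := (A_ f h c).
Local Notation Qtm := (Qtm f h c).
Local Notation Vtm := (Vtm f h c).
Local Notation Q := (Q f h c cA).
Local Notation V := (V f h c cA).
Local Notation max_accrued := (max_accrued f h c).
Implicit Types (o : sample T X U W N) (g : strategy T U Y) (t : nat).

Lemma A_S t o : A_ t.+1 o = A_ t o + c (inord t) (X_ t o) (U_ t o).
Proof. by rewrite /A_ big_ord_recr. Qed.

Lemma A_last o : A_ T.+1 o = A_ T o + c ord_max (X_ T o) (U_ T o).
Proof. by rewrite A_S; congr (_ + c _ _ _); apply/val_inj; rewrite /= inordK. Qed.

Lemma M_S_inj t o o' : M_ t.+1 o = M_ t.+1 o' ->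
  M_ t o = M_ t o' /\ U_ t o = U_ t o'.
Proof.
rewrite !M_S => -[] /rcons_inj[M1 _] /rcons_inj[M2 ->]; split=> //.
by rewrite [LHS]surjective_pairing M1 M2 -surjective_pairing.
Qed.

Definition set_action o t (u : U) : sample T X U W N :=
  (o.1, [ffun i => if i == inord t then u else o.2 i]).

Lemma U_set_action o t u : U_ t (set_action o t u) = u.
Proof. by rewrite /U_ ffunE eqxx. Qed.

Lemma U_set_action_neq o t u s : (s < t <= T)%N ->
  U_ s (set_action o t u) = U_ s o.
Proof.
case/andP=> st tT; rewrite /U_ ffunE ifN //; apply/eqP => /(congr1 val) /=.
by rewrite !inordK ?ltnS// ?(leq_trans (ltnW st))// => ts; rewrite ts ltnn in st.
Qed.

Lemma run_set_action o t u s : (s <= t <= T)%N ->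
  X_ s (set_action o t u) = X_ s o /\ M_ s (set_action o t u) = M_ s o.
Proof.
elim: s => [//|s IH] stT.
have [|Xs Ms] := IH; first by case/andP: stT => /ltnW ->.
by rewrite !M_S !X_S Xs Ms U_set_action_neq.
Qed.

Lemma A_set_action o t u : (t <= T)%N -> A_ t (set_action o t u) = A_ t o.
Proof.
move=> tT; apply: eq_bigr => l _; rewrite U_set_action_neq ?ltn_ord//.
by have [|-> _] := run_set_action o t u l; rewrite // ltnW ?ltn_ord.
Qed.

(** Replacing the action at time [t] by [u] in a sample changes none of X_t, M_t,
A_t, which depend on earlier actions only; so knowing U_t carries no information
on them. *)
Lemma bigmaxe_free_action t m u (Phi : X -> R -> \bar R) : (t <= T)%N ->
  \big[maxe/-oo%E]_(o | (M_ t o, U_ t o) == (m, u)) Phi (X_ t o) (A_ t o) =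
  \big[maxe/-oo%E]_(o | M_ t o == m) Phi (X_ t o) (A_ t o).
Proof.
move=> tT; apply: eq_upper_bounds => v; split=> /bigmaxe_finP le_v;
  apply/bigmaxe_finP => o; last first.
  by rewrite xpair_eqE => /andP[Mo _]; apply: le_v.
move=> /eqP Mo; have [|Xt Mt] := run_set_action o t u t; first by rewrite leqnn.
rewrite -Xt -(A_set_action o t u)//; apply: le_v.
by rewrite Mt U_set_action Mo.
Qed.

Lemma max_accruedE t m :
  max_accrued t m = (\big[maxe/-oo]_(o | M_ t o == m) (A_ t o)%:E)%E.
Proof. exact: bigmaxe_crange. Qed.

Lemma memoriesP t m : reflect (exists o, m = M_ t o) (m \in memories f h t).
Proof.
by apply: (iffP (imfsetP _ _ _ _)) => [[ o _ ->]|[ o ->]]; exists o.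
Qed.

Lemma M_memories t o : M_ t o \in memories f h t.
Proof. by apply/memoriesP; exists o. Qed.

Lemma max_accrued_fin_num t m :
  m \in memories f h t -> max_accrued t m \is a fin_num.
Proof.
move=> /memoriesP[ o ->]; rewrite max_accruedE.
by apply: (bigmaxe_fin_num _ _ _ o); apply: eqxx.
Qed.

(** * The two dynamic programs *)

(** The terminal objective c_T + A_T is the accrued cost one step past the
horizon. *)
Lemma Qtm_lastE m u :
  Qtm T m u = (\big[maxe/-oo]_(o | (M_ T o, U_ T o) == (m, u))
                 (A_ T.+1 o)%:E)%E.
Proof.
rewrite QtmT /Qtm_last bigmaxe_crange; apply: eq_bigr => o /eqP[_ <-] /=.
by rewrite A_last addrC.
Qed.

Lemma QtmE_samples t m u : (t < T)%N ->
  Qtm t m u = (\big[maxe/-oo]_(o | (M_ t o, U_ t o) == (m, u))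
                 Vtm t.+1 (M_ t.+1 o))%E.
Proof. by move=> tT; rewrite QtmE// /Qtm_step bigmaxe_crange. Qed.

(** Both sides maximize A_T + c_T(X_T, u) over the samples with memory [m]: the
normalization of r_T(. | m) is exactly what [max_accrued] adds back. *)
Lemma Q_last_accrued m u : m \in memories f h T ->
  Qtm T m u = (Q T m u + max_accrued T m)%E.
Proof.
move=> mT; have Kfin := max_accrued_fin_num _ _ mT.
rewrite QT /Q_last bigmaxeDr.
transitivity (\big[maxe/-oo%E]_(o | M_ T o == m)
    ((A_ T o)%:E + (c ord_max (X_ T o) u)%:E)%E); last first.
  rewrite -(bigmaxe_fibers _ _ (index_enum X) _ (X_ T)
    (fun x o => (A_ T o)%:E + (c ord_max x u)%:E)%E); last first.
    by move=> o; rewrite mem_index_enum.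
  apply: eq_bigr => x _; rewrite accrued_distE; last by move=> o; apply: A_in.
  by rewrite -max_accruedE -addeA subeK// addeC bigmaxeDr.
rewrite -(bigmaxe_free_action T m u
  (fun x a => a%:E + (c ord_max x u)%:E)%E)// Qtm_lastE.
apply: eq_bigr => o /eqP[_ <-].
by rewrite A_last EFinD.
Qed.

(** The normalization of r_t is the maximum of A_t given (m, u), and equals
max [[A_t | m]] because u is free.  After it cancels, two nested maxima over
samples with the same M_(t+1) merge into one, as M_(t+1) determines (M_t, U_t).
*)
Lemma Q_step_accrued t m u : (t < T)%N -> m \in memories f h t ->
  (forall m', m' \in memories f h t.+1 ->
     Vtm t.+1 m' = (V t.+1 m' + max_accrued t.+1 m')%E) ->
  Qtm t m u = (Q t m u + max_accrued t m)%E.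
Proof.
move=> tT mt VE; have Kfin := max_accrued_fin_num _ _ mt.
transitivity (\big[maxe/-oo%E]_(o | (M_ t o, U_ t o) == (m, u))
    ((A_ t o)%:E + ((c (inord t) (X_ t o) u)%:E + V t.+1 (M_ t.+1 o)))%E);
    last first.
  rewrite QE// /Q_step bigmaxeDr.
  rewrite -(bigmaxe_fibers _ _ (index_enum X) _ (X_ t)
    (fun x o => (A_ t o)%:E + ((c (inord t) x u)%:E + V t.+1 (M_ t.+1 o)))%E);
    last by move=> o; rewrite mem_index_enum.
  apply: eq_bigr => x _; rewrite bigmaxeDr.
  rewrite -(bigmaxe_fibers _ _ (memories f h t.+1) _ (M_ t.+1)
    (fun m' o => (A_ t o)%:E + ((c (inord t) x u)%:E + V t.+1 m'))%E);
    last by move=> o; apply: M_memories.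
  apply: eq_bigr => m' _; rewrite accrued_distE; last first.
    by move=> o; rewrite -{1}(inordK (leqW tT)); apply: A_in.
  rewrite (bigmaxe_free_action t m u (fun _ a => a%:E)) ?(ltnW tT)//.
  rewrite -max_accruedE -addeA subeK// addeC bigmaxeDr.
  by apply: eq_bigl => o; rewrite [(X_ t o, _) == _]xpair_eqE andbA.
rewrite QtmE_samples//; apply: eq_upper_bounds => v; split.
  move=> /bigmaxe_finP le_v; apply/bigmaxe_finP => o Gou.
  apply: le_trans (le_v _ Gou); rewrite VE ?M_memories// max_accruedE.
  have [_ Uo] := (eqP Gou).
  rewrite addeA addeC -EFinD -Uo -A_S; apply: leeD2l.
  by apply: (le_bigmax_cond _ (fun o' => (A_ t.+1 o')%:E)); apply: eqxx.
(* A sample o' with the same next memory as o has the same memory and action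
   at time t, so its accrued cost splits as A_t + c_t with this very u. *)
move=> /bigmaxe_finP le_v; apply/bigmaxe_finP => o Gou.
rewrite VE ?M_memories// max_accruedE addeC bigmaxeDr.
apply/bigmaxe_finP => o' /eqP Mo'; have [Mt Ut] := M_S_inj _ _ _ Mo'.
rewrite A_S EFinD -addeA -Mo'.
have Go' : (M_ t o', U_ t o') == (m, u) by rewrite Mt Ut.
by have := le_v _ Go'; case/eqP: Go' => _ <-.
Qed.

Lemma minval_accrued t m : m \in memories f h t ->
  (forall u, Qtm t m u = (Q t m u + max_accrued t m)%E) ->
  Vtm t m = (V t m + max_accrued t m)%E.
Proof.
move=> mt QE; rewrite /Vtm /V /minval bigmineDr ?max_accrued_fin_num//.
by apply: eq_bigr.
Qed.

Lemma Qtm_accrued t m u : (t <= T)%N -> m \in memories f h t ->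
  Qtm t m u = (Q t m u + max_accrued t m)%E.
Proof.
move=> tT; rewrite -(subKn tT); move: (T - t)%N (leq_subr t T) => k.
elim: k m u => [|k IH] m u kT; first by rewrite subn0; apply: Q_last_accrued.
move=> mt; apply: Q_step_accrued => //; first by rewrite ltn_subrL (leq_trans _ kT).
move=> m'; rewrite subnSK// => mt'; apply: minval_accrued => // u'.
by apply: IH => //; apply: ltnW.
Qed.

(** * Optimality *)

(** Strategies are compared on the open-loop sample space: the runs of [g] are the
samples whose actions at the times before [t] are those prescribed by [g]. *)
Fixpoint follows g t o : bool :=
  if t is s.+1 then follows g s o && (U_ s o == g (inord s) (M_ s o)) else true.

(** A memory records all past memories and actions, so it tells whether [g] was
obeyed. *)
Lemma eq_follows g t o o' : M_ t o = M_ t o' -> follows g t o = follows g t o'.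
Proof.
elim: t => [//|t IH] /M_S_inj[Mt Ut] /=.
by rewrite (IH Mt) Mt Ut.
Qed.

Lemma follows_le g s t o : (s <= t)%N -> follows g t o -> follows g s o.
Proof.
elim: t => [|t IH]; first by rewrite leqn0 => /eqP ->.
by rewrite leq_eqVlt => /predU1P[-> //|st] /andP[/(IH st)].
Qed.

Lemma run_follows g t o : follows g t o ->
  run f h g o.1 t = run f h (open_loop o) o.1 t.
Proof.
elim: t => [//|t IH] /= /andP[/IH -> /eqP Ut].
by move: Ut; rewrite /M_; case: (run _ _ _ _) => x m /= <-.
Qed.

Definition closed_loop g (xi : noise T X W N) : sample T X U W N :=
  (xi, [ffun i : 'I_T.+1 => run_action f h g xi i]).

Lemma follows_closed_loop g xi t : (t <= T.+1)%N ->
  follows g t (closed_loop g xi).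
Proof.
elim: t => [//|t IH] tT /=; have Ft := IH (ltnW tT).
by rewrite Ft /= /U_ /M_ -(run_follows g t _ Ft) ffunE /run_action inordK.
Qed.

Lemma total_cost_follows g o : follows g T.+1 o ->
  total_cost f h c g o.1 = A_ T.+1 o.
Proof.
move=> Fo; apply: eq_bigr => t _; have /andP[Ftt /eqP Ut] :=
  follows_le _ _ _ _ (ltn_ord t) Fo.
by rewrite inord_val /run_state /run_action run_follows// Ut /M_ inord_val.
Qed.

Lemma J_follows g :
  J f h c g = (\big[maxe/-oo]_(o | follows g T.+1 o) (A_ T.+1 o)%:E)%E.
Proof.
apply: eq_upper_bounds => v; split=> /bigmaxe_finP le_v; apply/bigmaxe_finP.
  by move=> o Fo; rewrite -(total_cost_follows g)//; apply: le_v.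
move=> xi _; have Fxi := follows_closed_loop g xi T.+1 (leqnn _).
by rewrite -[xi]/((closed_loop g xi).1) total_cost_follows//; apply: le_v.
Qed.

(** The samples which obey [g] through time [t] are all those passing through
(m, g_t(m)) for some memory [m] reachable under [g]: by [eq_follows], sharing
the memory of a sample which obeys [g] is enough. *)
Lemma bigmaxe_followsS g t (Psi : sample T X U W N -> \bar R) :
  \big[maxe/-oo%E]_(o | follows g t.+1 o) Psi o =
  \big[maxe/-oo%E]_(o | follows g t o)
    \big[maxe/-oo%E]_(o' | (M_ t o', U_ t o') ==
                           (M_ t o, g (inord t) (M_ t o))) Psi o'.
Proof.
apply: eq_upper_bounds => v; split=> /bigmaxe_finP le_v; apply/bigmaxe_finP.
  move=> o Fo; apply/bigmaxe_finP => o' /eqP[Mo' Uo']; apply: le_v => /=.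
  by rewrite (eq_follows _ _ _ _ Mo') Fo Uo' Mo' /=.
move=> o /andP[Fo /eqP Uo]; have /bigmaxe_finP := le_v o Fo.
by apply; rewrite Uo.
Qed.

Definition value g t : \bar R :=
  (\big[maxe/-oo]_(o | follows g t o) Vtm t (M_ t o))%E.

Definition action_value g t : \bar R :=
  (\big[maxe/-oo]_(o | follows g t o) Qtm t (M_ t o) (g (inord t) (M_ t o)))%E.

Lemma value_next g t : (t < T)%N -> value g t.+1 = action_value g t.
Proof.
move=> tT; rewrite /value bigmaxe_followsS.
by apply: eq_bigr => o _; rewrite QtmE_samples.
Qed.

Lemma J_action_value g : J f h c g = action_value g T.
Proof.
rewrite J_follows bigmaxe_followsS.
by apply: eq_bigr => o _; rewrite Qtm_lastE.
Qed.

Lemma value_le_action_value g t : (value g t <= action_value g t)%E.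
Proof. by apply: le_bigmax2 => o _; apply: bigmin_le. Qed.

(** The bound does not involve [g]: at time 0 no action has been taken, and
[value g 0] is the maximum of V^tm_0(M_0) over all samples. *)
Lemma value0_le_J g : (value g 0 <= J f h c g)%E.
Proof.
rewrite J_action_value.
have: (value g 0 <= value g T)%E.
  suff: forall t, (t <= T)%N -> (value g 0 <= value g t)%E by apply.
  elim=> [//|t IH] tT; apply: (le_trans (IH (ltnW tT))).
  by rewrite value_next// value_le_action_value.
by move=> /le_trans; apply; apply: value_le_action_value.
Qed.

Lemma J_eq_value0 g :
  (forall (t : 'I_T.+1) m, m \in memories f h t -> Vtm t m = Qtm t m (g t m)) ->
  J f h c g = value g 0.
Proof.
move=> Vg; have val_eq t : (t <= T)%N -> value g t = action_value g t.
  move=> tT; apply: eq_bigr => o _.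
  by have := Vg (inord t) (M_ t o); rewrite inordK// => -> //; apply: M_memories.
rewrite J_action_value -val_eq//.
suff: forall t, (t <= T)%N -> value g t = value g 0 by apply.
by elim=> [//|t IH] tT; rewrite value_next// -val_eq ?IH// ltnW.
Qed.

Lemma optimal_strategy g :
  (forall (t : 'I_T.+1) m, m \in memories f h t ->
     forall u, (Q t m (g t m) <= Q t m u)%E) ->
  forall g', (J f h c g <= J f h c g')%E.
Proof.
move=> gmin g'; rewrite J_eq_value0; first exact: (value0_le_J g').
move=> t m mt; apply/le_anti/andP; split; first exact: bigmin_le.
apply/bigmin_geP; split=> [|u _]; first exact: leey.
by rewrite !Qtm_accrued ?leeD2r ?gmin// -ltnS.
Qed.

End System.

Theorem theorem1 (R : realType) (S : metricType R) (T : nat)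
  (X U Y W N : {fset S})
  (X0 : X != fset0) (U0 : U != fset0) (Y0 : Y != fset0) (W0 : W != fset0)
  (N0 : N != fset0)
  (f : 'I_T -> X -> U -> W -> X) (h : 'I_T.+1 -> X -> N -> Y)
  (c : 'I_T.+1 -> X -> U -> R)
  (c_ge0 : forall t x u, 0 <= c t x u)
  (cA : 'I_T.+1 -> {fset R})
  (cA_ge0 : forall t a, a \in cA t -> 0 <= a)
  (A_in : forall (t : 'I_T.+1) (o : sample T X U W N), A_ f h c t o \in cA t) :
  (forall t : nat, (t <= T)%N -> forall m, m \in memories f h t ->
     (forall u : U,
        Qtm f h c t m u = (Q f h c cA t m u + max_accrued f h c t m)%E) /\
     Vtm f h c t m = (V f h c cA t m + max_accrued f h c t m)%E) /\
  (forall g : strategy T U Y,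
     (forall (t : 'I_T.+1) m, m \in memories f h t ->
        forall u : U, (Q f h c cA t m (g t m) <= Q f h c cA t m u)%E) ->
     forall g' : strategy T U Y, (J f h c g <= J f h c g')%E).
Proof.
split; last exact: optimal_strategy.
move=> t tT m mt; have QA u := Qtm_accrued f h c cA A_in t m u tT mt.
by split=> //; apply: minval_accrued.
Qed.
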